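(* Let $n\ge 3$ be a positive integer and let $B_n=\bigl(\sin(\tfrac{2jk\pi}{n})\bigr)_{j,k\in S_n}$. Then $$|\det(B_n)|=\begin{cases}2^{-\phi(n)/2}\displaystyle\prod_{\substack{\chi \bmod n\\ \chi\ \mathrm{odd}}}\sqrt{f_\chi} & \text{when } n \text{ is odd and square-free},\\[8pt] 2^{-\phi(n/2)/2}\displaystyle\prod_{\substack{\chi \bmod n/2\\ \chi\ \mathrm{odd}}}\sqrt{f_\chi} & \text{when } n \text{ is even and square-free},\\[8pt] 0 & \text{otherwise.}\end{cases}$$
   Context: $\phi$ is Euler's function. $S_n=\{a\in\mathbb{Z} : 1\le a<n/2,\ \gcd(a,n)=1\}$. The products run over all odd Dirichlet characters $\chi$ (i.e. $\chi(-1)=-1$) of the indicated modulus, primitive or not, and $f_\chi$ is the conductor of $\chi$.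
   Formalization: The case n = 4 is excluded, because the claim fails there: S_4 = {1} and B_4 = (sin(π/2)) = (1), so |det(B_4)| = 1, whereas 4 is not square-free and the stated value is 0. *)

(* Defs.v *)
From HB Require Import structures.
From mathcomp Require Import all_boot all_order all_algebra all_fingroup.
From mathcomp Require Import all_solvable all_field all_character.
From mathcomp Require Import reals exp trigo.

Set Implicit Arguments.
Unset Strict Implicit.
Unset Printing Implicit Defensive.

Import Order.TTheory GRing.Theory Num.Theory.

Local Open Scope ring_scope.

Definition squarefree (n : nat) : bool :=
  [forall d : 'I_n.+1, (d ^ 2 %| n)%N ==> (d == 1 :> nat)].

(* All elements of S_n are less than n, so S_n is a set of ordinals. *)
Definition S_set (n : nat) : {set 'I_n} :=
  [set a : 'I_n | [&& (1 <= a)%N, (2 * a < n)%N & coprime a n]].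

Definition S_val (n : nat) (j : 'I_#|S_set n|) : nat := enum_val j.

Definition sin_mx (R : realType) (n : nat) : 'M[R]_#|S_set n| :=
  \matrix_(j, k) sin ((2 * S_val j * S_val k)%:R * pi / n%:R).

(* The group (Z/n)^* being abelian, its irreducible complex characters are
   exactly its homomorphisms to the nonzero complex numbers (and these have
   algebraic values); the Dirichlet characters modulo n are their extensions
   by 0 to the integers that are not coprime to n.  The default value of
   insubd is used only for n = 1, where every integer is a unit although 'Z_1
   is Z/2; as {unit 'Z_1} is trivial, the only character is then the constant
   1, as it should be. *)
Definition dirichlet_char (n : nat) (i : Iirr (units_Zp n)) (a : int) : algC :=
  if coprimez a n%:Z then
    'chi[units_Zp n]_i (insubd (1%g : {unit 'Z_n}) (a%:~R : 'Z_n))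
  else 0.

Definition odd_char (n : nat) (i : Iirr (units_Zp n)) : bool :=
  dirichlet_char i (- 1) == - 1.

(* Both sides are periodic modulo n when d divides n, so it is enough to test
   the residues 0 <= a < n. *)
Definition induced_from (n : nat) (i : Iirr (units_Zp n)) (d : nat) : bool :=
  [exists j : Iirr (units_Zp d), forall a : 'I_n,
     coprime a n ==>
       (dirichlet_char i (a : nat)%:Z == dirichlet_char j (a : nat)%:Z)].

(* The divisors of n are listed in increasing order, and n itself always
   satisfies the test, so for n > 0 this is the least modulus d dividing n
   such that the character is induced from a character modulo d. *)
Definition conductor (n : nat) (i : Iirr (units_Zp n)) : nat :=
  head n [seq d <- divisors n | induced_from i d].

(* Main.v *)
Require Import Defs.
From mathcomp Require Import all_boot all_order all_algebra all_fingroup.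
From mathcomp Require Import all_solvable all_field all_character.
From mathcomp Require Import reals exp trigo.
From mathcomp Require Import complex.
From mathcomp Require Import zify ring lra.

Set Implicit Arguments.
Unset Strict Implicit.
Unset Printing Implicit Defensive.

Import Order.TTheory GRing.Theory Num.Theory.

Local Open Scope ring_scope.

(** Let m be n for odd n and n / 2 for even n, and z a primitive m-th root of
    unity.  Up to a constant of absolute value 2, the entry sin (2 pi j k / n)
    is z^(jk) - z^(-jk), where j and k run over representatives of the units
    modulo m up to sign ([half_system]).  For n = 2 m with m odd the set S_n
    consists of the odd units below m, and for odd jk the number
    exp (i pi jk / m) is minus the jk-th power of the primitive m-th root of
    unity - exp (i pi / m).

    Multiplying the matrix A = (z^(jk) - z^(-jk)) by the matrix X of the values
    of the odd characters diagonalizes it: X A = D X^bar, where D has the Gauss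
    sums of the odd characters on its diagonal, and X is invertible by the
    orthogonality relations.  So |det A| is the product of the |tau(chi)|
    ([norm_det_sine_mx]).

    For squarefree m the Gauss sum of a character modulo m, primitive or not,
    has norm sqrt f_chi.  By the Chinese remainder theorem the Gauss sum is, up
    to a root of unity, the product of the Gauss sums of the components of chi
    modulo the primes p dividing m; each of these is -1 if the component is
    trivial and has norm sqrt p otherwise ([norm_gauss_sum_squarefree]).  The
    conductor is the product of the p with a nontrivial component
    ([conductor_squarefree]).

    Characters take their values in algC whereas the sines live in an arbitrary
    R.  Conjugation maps A to - A, so that the result reads
    (-1)^r (det A)^2 = prod f_chi, where r is the size of A: a polynomial
    identity in z with integer coefficients.  As the cyclotomic polynomial is
    the minimal polynomial of z over the rationals, the identity then holds for
    every primitive m-th root of unity in every field of characteristic 0, and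
    in particular in R[i] ([root_prim_root_transfer]).

    If n, even or odd, has a square factor p^2, take m = n instead, and put
    d = n / p.  The residues congruent to a given unit c modulo d are units,
    because p divides d, and the sum of z^(ak) over them is 0 for k prime to p.
    This is a linear relation between the rows of A, whose coefficients are not
    all 0 unless c = - c modulo d, that is, d = 2 and n = 4
    ([det_sine_mx_eq0]). *)

(** * Sums of periodic functions *)

Definition periodic (V : Type) (n : nat) (h : nat -> V) :=
  forall a, h (a %% n)%N = h a.

Lemma periodic_eqmod (V : Type) n (h : nat -> V) a b :
  periodic n h -> a = b %[mod n] -> h a = h b.
Proof. by move=> hP e; rewrite -[LHS]hP e hP. Qed.

Lemma sum_periodic_inj (V : nmodType) n (h : nat -> V) (g : nat -> nat) :
    (0 < n)%N -> periodic n h ->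
    (forall a b, (a < n)%N -> (b < n)%N -> g a = g b %[mod n] -> a = b) ->
  \sum_(a < n) h (g a) = \sum_(a < n) h a.
Proof.
move=> n_gt0 hP g_inj.
pose f (a : 'I_n) : 'I_n := Ordinal (ltn_pmod (g a) n_gt0).
have f_inj : injective f.
  by move=> a b /(congr1 val) /= /(g_inj _ _ (ltn_ord a) (ltn_ord b)) /val_inj.
rewrite [RHS](reindex_inj f_inj).
by apply: eq_bigr => a _; rewrite /= hP.
Qed.

Lemma sum_periodic_shift (V : nmodType) n (h : nat -> V) d :
  (0 < n)%N -> periodic n h -> \sum_(a < n) h (a + d)%N = \sum_(a < n) h a.
Proof.
move=> n_gt0 hP; apply: (sum_periodic_inj (g := fun a => a + d)%N) => // a b an bn.
by move/eqP; rewrite eqn_modDr !modn_small // => /eqP.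
Qed.

Lemma sum_periodic_scale (V : nmodType) n (h : nat -> V) c :
  (0 < n)%N -> periodic n h -> coprime c n ->
  \sum_(a < n) h (c * a)%N = \sum_(a < n) h a.
Proof.
move=> n_gt0 hP co_cn; apply: (sum_periodic_inj (g := fun a => c * a)%N) => //.
move=> a b an bn /eqP; wlog le_ba : a b an bn / (b <= a)%N => [IH|].
  have [|/ltnW le_ab] := leqP b a; first exact: IH.
  by rewrite eq_sym => e; apply/esym; apply: IH.
rewrite eqn_mod_dvd ?leq_mul2l ?le_ba ?orbT // -mulnBr Gauss_dvdr 1?coprime_sym //.
by rewrite -eqn_mod_dvd // !modn_small // => /eqP.
Qed.

(** Chinese remaindering of a sum: (x, y) |-> q x + p y is a bijection from
    Z/p x Z/q to Z/pq. *)
Lemma sum_periodic_mul (V : nmodType) p q (h : nat -> V) :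
    (0 < p)%N -> (0 < q)%N -> coprime p q -> periodic (p * q) h ->
  \sum_(a < p * q) h a = \sum_(x < p) \sum_(y < q) h (q * x + p * y)%N.
Proof.
move=> p_gt0 q_gt0 co_pq hP.
have pq_gt0 : (0 < p * q)%N by rewrite muln_gt0 p_gt0.
pose f (u : 'I_p * 'I_q) : 'I_(p * q) :=
  Ordinal (ltn_pmod (q * u.1 + p * u.2) pq_gt0).
have f_inj : injective f.
  move=> [x y] [x' y'] /(congr1 val) /= /eqP.
  (* Modulo p only q x is left, and modulo q only p y. *)
  rewrite chinese_remainder // => /andP[].
  rewrite -(modnDm _ (p * y)) -(modnDm _ (p * y')) ![(p * _)%N]mulnC !modnMl !addn0 !modn_mod.
  rewrite -(modnDm (q * x)) -(modnDm (q * x')) ![(q * _)%N]mulnC !modnMl !add0n !modn_mod.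
  have canc r s (a b : 'I_r) : coprime r s -> (a * s == b * s %[mod r])%N -> a = b.
    move=> co_rs; wlog le_ba : a b / (b <= a)%N => [IH|].
      have [|/ltnW le_ab] := leqP b a; first exact: IH.
      by rewrite eq_sym => e; apply/esym; apply: IH.
    rewrite eqn_mod_dvd ?leq_mul2r ?le_ba ?orbT // -mulnBl Gauss_dvdl //.
    by rewrite -eqn_mod_dvd // !modn_small // => /eqP/val_inj.
  move=> ex ey; congr (_, _); first exact: (canc p q).
  by apply: (canc q p); rewrite 1?coprime_sym.
have f_bij : bijective f.
  by apply: inj_card_bij => //; rewrite card_prod !card_ord.
rewrite pair_big /= (reindex f) /=; last exact: onW_bij.
by apply: eq_bigr => u _; rewrite hP.
Qed.

(** * Dirichlet characters and their Chinese remainder components *)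

(** Dirichlet characters modulo n, as functions on the natural numbers. *)
Definition dirichlet_fun (n : nat) (chi : nat -> algC) :=
  [/\ chi 1%N = 1, {morph chi : a b / (a * b)%N >-> a * b}, periodic n chi
    & forall a, ~~ coprime a n -> chi a = 0].

Section DirichletFun.

Variables (n : nat) (chi : nat -> algC).
Hypotheses (n_gt0 : (0 < n)%N) (chiP : dirichlet_fun n chi).

Lemma dirichlet_fun1 : chi 1%N = 1. Proof. by case: chiP. Qed.
Lemma dirichlet_funM a b : chi (a * b)%N = chi a * chi b.
Proof. by case: chiP => _ ->. Qed.
Lemma dirichlet_fun_mod : periodic n chi. Proof. by case: chiP. Qed.
Lemma dirichlet_fun0 a : ~~ coprime a n -> chi a = 0.
Proof. by case: chiP => _ _ _; apply. Qed.

Lemma dirichlet_funX a k : chi (a ^ k)%N = chi a ^+ k.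
Proof.
elim: k => [|k IH]; first exact: dirichlet_fun1.
by rewrite expnS dirichlet_funM IH exprS.
Qed.

Lemma dirichlet_fun_norm a : coprime a n -> `|chi a| = 1.
Proof.
move=> co_an; apply/eqP; rewrite -(@pexpr_eq1 _ _ (totient n)) ?totient_gt0 //.
rewrite -normrX -dirichlet_funX.
have -> : chi (a ^ totient n)%N = chi 1%N.
  exact: (periodic_eqmod dirichlet_fun_mod (Euler_exp_totient co_an)).
by rewrite dirichlet_fun1 normr1.
Qed.

Lemma dirichlet_fun_conjM a : coprime a n -> chi a * (chi a)^* = 1.
Proof. by move=> co_an; rewrite -normCK dirichlet_fun_norm // expr1n. Qed.

(** The sum of a nontrivial character over all residues vanishes, being
    invariant under multiplication by a value of the character other than 1. *)
Lemma dirichlet_fun_sum0 c :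
  coprime c n -> chi c != 1 -> \sum_(a < n) chi a = 0.
Proof.
move=> co_cn chi_c; apply/eqP; move: chi_c; apply: contraR => s_neq0.
rewrite -subr_eq0 -(mulIr_eq0 _ (mulIf s_neq0)) mulrBl mul1r subr_eq0.
rewrite -[X in _ == X](sum_periodic_scale n_gt0 dirichlet_fun_mod co_cn) mulr_sumr.
by apply/eqP/eq_bigr => a _; rewrite dirichlet_funM.
Qed.

End DirichletFun.

(** The component modulo p of a function on Z/pq = Z/p x Z/q. *)
Definition crt_part (p q : nat) (chi : nat -> algC) (a : nat) :=
  chi (chinese p q a 1).

Section Crt.

Variables (p q : nat) (chi : nat -> algC).
Hypothesis co_pq : coprime p q.

Lemma coprime_chinese a b :
  coprime (chinese p q a b) (p * q) = coprime a p && coprime b q.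
Proof.
rewrite coprimeMr -coprime_modl chinese_modl // coprime_modl.
by rewrite -[X in _ && X]coprime_modl chinese_modr // coprime_modl.
Qed.

Lemma eq_chinese x a b : x = a %[mod p] -> x = b %[mod q] ->
  x = chinese p q a b %[mod p * q].
Proof.
move=> xa xb; apply/eqP; rewrite chinese_remainder // chinese_modl //.
by rewrite chinese_modr // xa xb !eqxx.
Qed.

Hypothesis chiP : dirichlet_fun (p * q) chi.
Let chi_mod := dirichlet_fun_mod chiP.

Lemma crt_part_dirichlet : dirichlet_fun p (crt_part p q chi).
Proof.
rewrite /crt_part; split.
- rewrite -(dirichlet_fun1 chiP).
  by apply/esym/(periodic_eqmod chi_mod)/eq_chinese.
- move=> a b; rewrite -(dirichlet_funM chiP); apply/esym/(periodic_eqmod chi_mod).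
  apply: eq_chinese.
    by rewrite -modnMm !chinese_modl // modnMm.
  by rewrite -modnMm !chinese_modr // modnMm.
- move=> a; apply/(periodic_eqmod chi_mod)/eq_chinese.
    by rewrite chinese_modl // modn_mod.
  by rewrite chinese_modr.
- by move=> a co_ap; rewrite (dirichlet_fun0 chiP) // coprime_chinese (negPf co_ap).
Qed.

End Crt.

Lemma crt_part_split p q chi a : coprime p q -> dirichlet_fun (p * q) chi ->
  chi a = crt_part p q chi a * crt_part q p chi a.
Proof.
move=> co_pq chiP; rewrite -(dirichlet_funM chiP).
apply: (periodic_eqmod (dirichlet_fun_mod chiP)); apply/eqP.
have co_qp : coprime q p by rewrite coprime_sym.
rewrite chinese_remainder // -(modnMm _ _ p) -(modnMm _ _ q).
rewrite (chinese_modl co_pq) (chinese_modr co_pq) (chinese_modr co_qp) (chinese_modl co_qp).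
by rewrite !modnMm muln1 mul1n !eqxx.
Qed.

(** * Gauss sums *)

Definition gauss_sum (n : nat) (chi : nat -> algC) (z : algC) :=
  \sum_(a < n) chi a * z ^+ a.

Lemma periodic_expr (R : pzRingType) n (z : R) :
  z ^+ n = 1 -> periodic n (fun a => z ^+ a).
Proof.
by move=> zn a; rewrite [in RHS](divn_eq a n) exprD mulnC exprM zn expr1n mul1r.
Qed.

(** Substitute k a for a in the sum. *)
Lemma gauss_sum_expr n chi z k : (0 < n)%N -> dirichlet_fun n chi -> z ^+ n = 1 ->
  coprime k n -> gauss_sum n chi (z ^+ k) = (chi k)^* * gauss_sum n chi z.
Proof.
move=> n_gt0 chiP zn co_kn.
have hP : periodic n (fun a => chi a * z ^+ a).
  by move=> a; rewrite (dirichlet_fun_mod chiP) (periodic_expr zn).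
rewrite /gauss_sum -[in RHS](sum_periodic_scale n_gt0 hP co_kn) mulr_sumr.
apply: eq_bigr => a _; rewrite (dirichlet_funM chiP) !mulrA [_^* * _]mulrC.
by rewrite (dirichlet_fun_conjM n_gt0 chiP co_kn) mul1r exprM.
Qed.

(** Gauss sums are multiplicative up to a root of unity: write the summation
    variable as q x + p y. *)
Lemma gauss_sum_mul p q chi z : (0 < p)%N -> (0 < q)%N -> coprime p q ->
    dirichlet_fun (p * q) chi -> z ^+ (p * q) = 1 ->
  `|gauss_sum (p * q) chi z| =
    `|gauss_sum p (crt_part p q chi) (z ^+ q)| *
    `|gauss_sum q (crt_part q p chi) (z ^+ p)|.
Proof.
move=> p_gt0 q_gt0 co_pq chiP zn.
have co_qp : coprime q p by rewrite coprime_sym.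
have chiP' : dirichlet_fun (q * p) chi by rewrite mulnC.
have cP := crt_part_dirichlet co_pq chiP; have cQ := crt_part_dirichlet co_qp chiP'.
have hP : periodic (p * q) (fun a => chi a * z ^+ a).
  by move=> a; rewrite (dirichlet_fun_mod chiP) (periodic_expr zn).
rewrite /gauss_sum (sum_periodic_mul p_gt0 q_gt0 co_pq hP).
have cq1 := dirichlet_fun_norm p_gt0 cP co_qp.
have cp1 := dirichlet_fun_norm q_gt0 cQ co_pq.
rewrite -[RHS]mulr1 -cq1 -[RHS]mulr1 -cp1 -!normrM; congr `|_|.
rewrite !mulr_suml; apply: eq_bigr => x _.
rewrite mulr_sumr !mulr_suml; apply: eq_bigr => y _.
rewrite (crt_part_split (q * x + p * y) co_pq chiP).
have -> : crt_part p q chi (q * x + p * y) = crt_part p q chi q * crt_part p q chi x.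
  rewrite -(dirichlet_funM cP); apply: (periodic_eqmod (dirichlet_fun_mod cP)).
  by rewrite addnC mulnC modnMDl.
have -> : crt_part q p chi (q * x + p * y) = crt_part q p chi p * crt_part q p chi y.
  rewrite -(dirichlet_funM cQ); apply: (periodic_eqmod (dirichlet_fun_mod cQ)).
  by rewrite mulnC modnMDl.
by rewrite exprD !exprM; ring.
Qed.

Lemma sum_expr_unity (F : fieldType) n (z : F) :
  z ^+ n = 1 -> \sum_(a < n) z ^+ a = if z == 1 then n%:R else 0.
Proof.
move=> zn; case: eqVneq => [->|z_neq1].
  under eq_bigr do rewrite expr1n.
  by rewrite sumr_const card_ord.
by apply: (mulfI (_ : z - 1 != 0)); rewrite ?subr_eq0 // -subrX1 zn subrr mulr0.
Qed.

Lemma unity_root_neq0 (F : fieldType) n (z : F) :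
  (0 < n)%N -> z ^+ n = 1 -> z != 0.
Proof.
by move=> n_gt0 /eqP; apply: contraTneq => ->; rewrite expr0n gtn_eqF // eq_sym oner_eq0.
Qed.

Lemma norm_unity_root n (z : algC) : (0 < n)%N -> z ^+ n = 1 -> `|z| = 1.
Proof.
by move=> n_gt0 zn; apply/eqP; rewrite -(@pexpr_eq1 _ _ n) // -normrX zn normr1.
Qed.

Lemma conj_unity_root n (z : algC) : (0 < n)%N -> z ^+ n = 1 -> z^* = z^-1.
Proof.
move=> n_gt0 zn; have z1 := norm_unity_root n_gt0 zn.
by rewrite invC_norm z1 expr1n invr1 mul1r.
Qed.

(** Parseval's identity for the finite Fourier transform. *)
Lemma sum_norm_gauss_sum n chi z : n.-primitive_root z ->
  \sum_(k < n) `|gauss_sum n chi (z ^+ k)| ^+ 2 = n%:R * \sum_(a < n) `|chi a| ^+ 2.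
Proof.
move=> z_prim; have n_gt0 := prim_order_gt0 z_prim.
have zn := prim_expr_order z_prim.
have z_neq0 := unity_root_neq0 n_gt0 zn.
transitivity (\sum_(a < n) \sum_(b < n)
    chi a * (chi b)^* * \sum_(k < n) (z ^+ a * (z ^+ b)^-1) ^+ k).
  transitivity (\sum_(k < n) \sum_(a < n) \sum_(b < n)
      chi a * (chi b)^* * (z ^+ a * (z ^+ b)^-1) ^+ k).
    apply: eq_bigr => k _; rewrite normCK rmorph_sum /= mulr_suml.
    apply: eq_bigr => a _; rewrite mulr_sumr; apply: eq_bigr => b _.
    rewrite rmorphM /= !rmorphXn /= (conj_unity_root n_gt0 zn) exprMn -!exprM.
    by rewrite !exprVn -!exprM ![(k * _)%N]mulnC; ring.
  rewrite exchange_big; apply: eq_bigr => a _.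
  rewrite exchange_big; apply: eq_bigr => b _.
  by rewrite mulr_sumr.
rewrite mulr_sumr; apply: eq_bigr => a _.
rewrite (bigD1 a) //= [X in _ + X]big1 => [|b b_neq_a].
  rewrite divff ?expf_neq0 // sum_expr_unity ?expr1n // eqxx normCK addr0.
  by rewrite mulrC.
rewrite sum_expr_unity; last first.
  by rewrite exprMn -exprVn -!exprM ![(_ * n)%N]mulnC !exprM exprVn zn invr1 !expr1n mulr1.
rewrite -(inj_eq (mulIf (expf_neq0 b z_neq0))) mulfVK ?expf_neq0 // mul1r.
rewrite (eq_prim_root_expr z_prim) !modn_small // eq_sym (inj_eq val_inj).
by rewrite (negPf b_neq_a) mulr0.
Qed.

(** For d dividing n, triviality on the kernel of the reduction
    (Z/n)^* -> (Z/d)^* is what it takes for chi to come from (Z/d)^*. *)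
Definition factors_mod (n : nat) (chi : nat -> algC) (d : nat) : bool :=
  [forall a : 'I_n, coprime a n && (a == 1 %[mod d])%N ==> (chi a == 1)].

Lemma factors_modP n chi d : (0 < n)%N -> (d %| n)%N -> periodic n chi ->
  reflect (forall a, coprime a n -> a = 1 %[mod d] -> chi a = 1)
          (factors_mod n chi d).
Proof.
move=> n_gt0 d_n chi_mod; apply: (iffP forallP) => [chi1 a co_an a1 | chi1 a].
  have /= := chi1 (Ordinal (ltn_pmod a n_gt0)).
  by rewrite coprime_modl co_an (modn_dvdm _ d_n) a1 eqxx chi_mod => /eqP.
by apply/implyP => /andP[co_an /eqP a1]; apply/eqP/chi1.
Qed.

Lemma sum_norm_dirichlet_fun p chi : prime p -> dirichlet_fun p chi ->
  \sum_(a < p) `|chi a| ^+ 2 = p.-1%:R.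
Proof.
move=> p_prime chiP; case: p p_prime chiP => // p p_prime chiP.
rewrite big_ord_recl (dirichlet_fun0 chiP) ?normr0 ?expr0n ?add0r; last first.
  by rewrite /coprime gcd0n; case: p p_prime {chiP}.
rewrite (eq_bigr (fun=> 1)) ?sumr_const ?card_ord // => a _.
rewrite (dirichlet_fun_norm _ chiP) ?expr1n //.
by rewrite coprime_sym prime_coprime // gtnNdvd.
Qed.

Lemma coprime_prime_lt p a : prime p -> (0 < a < p)%N -> coprime a p.
Proof. by move=> pp /andP[a0 ap]; rewrite coprime_sym prime_coprime // gtnNdvd. Qed.

(** For nontrivial chi all the terms k <> 0 of Parseval's identity are equal
    to the squared norm of the Gauss sum, and the term k = 0 vanishes. *)
Lemma norm_gauss_sum_prime p chi z :
    prime p -> dirichlet_fun p chi -> p.-primitive_root z ->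
  `|gauss_sum p chi z| ^+ 2 = (if factors_mod p chi 1 then 1 else p)%:R.
Proof.
move=> p_prime chiP z_prim; have p_gt1 := prime_gt1 p_prime.
have p_gt0 := ltnW p_gt1; have zp := prim_expr_order z_prim.
have chi0 : chi 0%N = 0.
  by rewrite (dirichlet_fun0 chiP) // /coprime gcd0n neq_ltn p_gt1 orbT.
have ltp (a : 'I_p.-1) : (a.+1 < p)%N by rewrite -ltn_predRL.
case: ifPn => [/(factors_modP p_gt0 (dvd1n p) (dirichlet_fun_mod chiP)) chi1|].
  have -> : gauss_sum p chi z = -1.
    have := sum_expr_unity zp.
    have /negPf-> : z != 1.
      by rewrite -[z]expr1 -(prim_order_dvd z_prim) dvdn1 neq_ltn p_gt1 orbT.
    rewrite /gauss_sum -(prednK p_gt0) !big_ord_recl chi0 mul0r add0r expr0.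
    move/eqP; rewrite addrC addr_eq0 => /eqP <-.
    apply: eq_bigr => a _; rewrite chi1 ?mul1r // ?modn1 //.
    by rewrite coprime_prime_lt // ltp.
  by rewrite normrN1 expr1n.
rewrite negb_forall => /existsP[c].
rewrite negb_imply => /andP[/andP[co_cp _] chi_c].
have p1_neq0 : p.-1%:R != 0 :> algC by rewrite pnatr_eq0 -lt0n -ltnS prednK.
apply: (mulfI p1_neq0).
rewrite [RHS]mulrC -(sum_norm_dirichlet_fun p_prime chiP) -(sum_norm_gauss_sum _ z_prim).
rewrite (sum_norm_dirichlet_fun p_prime chiP).
have split_sum (F : nat -> algC) :
    \sum_(k < p) F k = F 0%N + \sum_(k < p.-1) F k.+1.
  by case: (p) p_gt0 => // p' _; rewrite big_ord_recl.
rewrite (split_sum (fun k => `|gauss_sum p chi (z ^+ k)| ^+ 2)) expr0.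
have -> : gauss_sum p chi 1 = 0.
  rewrite -(dirichlet_fun_sum0 p_gt0 chiP co_cp chi_c).
  by apply: eq_bigr => a _; rewrite expr1n mulr1.
rewrite normr0 expr0n add0r.
rewrite (eq_bigr (fun=> `|gauss_sum p chi z| ^+ 2)) => [|k _].
  by rewrite sumr_const card_ord mulr_natl.
rewrite (gauss_sum_expr p_gt0 chiP zp) ?coprime_prime_lt ?ltp // normrM norm_conjC.
by rewrite (dirichlet_fun_norm p_gt0 chiP) ?mul1r ?coprime_prime_lt ?ltp.
Qed.

Lemma squarefree_dvd m n : (0 < n)%N -> (m %| n)%N -> squarefree n -> squarefree m.
Proof.
move=> n_gt0 m_n /forallP sq; apply/forallP => d; apply/implyP => d2.
have d_n : (d < n.+1)%N by rewrite (leq_trans (ltn_ord d)) // ltnS dvdn_leq.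
by have /implyP := sq (Ordinal d_n); apply; apply: dvdn_trans m_n.
Qed.

Lemma squarefree_coprime p q : (0 < p * q)%N -> squarefree (p * q) -> coprime p q.
Proof.
move=> pq_gt0 /forallP sq; have g_n : (gcdn p q < (p * q).+1)%N.
  by rewrite ltnS dvdn_leq // dvdn_mulr // dvdn_gcdl.
by have /implyP := sq (Ordinal g_n); apply; rewrite -mulnn dvdn_mul ?dvdn_gcdl ?dvdn_gcdr.
Qed.

(** For squarefree n and a prime p dividing n, this says that chi is nontrivial
    on the factor (Z/p)^* of (Z/n)^* = (Z/p)^* x (Z/(n/p))^*. *)
Definition ramified (n : nat) (chi : nat -> algC) (p : nat) : bool :=
  ~~ factors_mod n chi (n %/ p).

Lemma ramified_crt_part p q chi r : (0 < p * q)%N -> coprime p q ->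
    dirichlet_fun (p * q) chi -> prime r -> (r %| p)%N ->
  ramified (p * q) chi r = ramified p (crt_part p q chi) r.
Proof.
move=> pq_gt0 co_pq chiP r_prime r_p; congr (~~ _).
have /andP[p_gt0 q_gt0] : (0 < p)%N && (0 < q)%N by rewrite -muln_gt0.
have cP := crt_part_dirichlet co_pq chiP.
have d1 : (p * q %/ r %| p * q)%N by rewrite dvdn_div // dvdn_mulr.
have d2 : (p %/ r %| p)%N by rewrite dvdn_div.
have co : coprime (p %/ r) q by apply: coprime_dvdl co_pq.
have E : (p * q %/ r = p %/ r * q)%N by rewrite mulnC -muln_divA // mulnC.
have chi_mod := dirichlet_fun_mod chiP; have cP_mod := dirichlet_fun_mod cP.
apply/(factors_modP pq_gt0 d1 chi_mod)/(factors_modP p_gt0 d2 cP_mod).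
  move=> chi1 a co_ap a1; apply: chi1.
    by rewrite coprime_chinese // co_ap coprime1n.
  apply/eqP; rewrite E chinese_remainder // (chinese_modr co_pq) eqxx andbT.
  by rewrite -a1 -(modn_dvdm _ d2) (chinese_modl co_pq) modn_dvdm.
move=> chi1 a co_a; rewrite E => /eqP; rewrite chinese_remainder // => /andP[/eqP a1 /eqP a1'].
rewrite -(chi1 a) //; last by move: co_a; rewrite coprimeMr => /andP[].
exact/(periodic_eqmod (dirichlet_fun_mod chiP))/eq_chinese.
Qed.

(** The absolute value of a Gauss sum is multiplicative and so is the product of
    the ramified primes, which reduces the claim to prime n. *)
Lemma norm_gauss_sum_squarefree n chi z :
    squarefree n -> dirichlet_fun n chi -> n.-primitive_root z ->
  `|gauss_sum n chi z| ^+ 2 = (\prod_(p <- primes n | ramified n chi p) p)%:R.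
Proof.
have [m] := ubnP n; elim: m => // m IH in n chi z *.
rewrite ltnS => le_nm sq chiP z_prim; have n_gt0 := prim_order_gt0 z_prim.
have [n_le1|n_gt1] := leqP n 1.
  have n1 : n = 1%N by apply/eqP; rewrite eqn_leq n_le1.
  rewrite n1 in chiP *; rewrite big_nil /gauss_sum big_ord1 expr0 mulr1.
  by rewrite -(dirichlet_fun_mod chiP) modn1 -(modn1 1) (dirichlet_fun_mod chiP)
     (dirichlet_fun1 chiP) normr1 expr1n.
pose p := pdiv n; pose q := (n %/ p)%N.
have p_prime : prime p by apply: pdiv_prime.
have p_n : (p %| n)%N by apply: pdiv_dvd.
have n_pq : (n = p * q)%N by rewrite mulnC divnK.
have p_gt0 := prime_gt0 p_prime.
have q_gt0 : (0 < q)%N by move: n_gt0; rewrite n_pq muln_gt0 => /andP[].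
clearbody p q; subst n.
have co_pq := squarefree_coprime n_gt0 sq.
have co_qp : coprime q p by rewrite coprime_sym.
have chiP' : dirichlet_fun (q * p) chi by rewrite mulnC.
have cP := crt_part_dirichlet co_pq chiP; have cQ := crt_part_dirichlet co_qp chiP'.
rewrite gauss_sum_mul ?(prim_expr_order z_prim) // exprMn.
have zp_prim : p.-primitive_root (z ^+ q).
  by have := dvdn_prim_root z_prim p_n; rewrite mulKn.
have zq_prim : q.-primitive_root (z ^+ p).
  by have := dvdn_prim_root z_prim (dvdn_mull p (dvdnn q)); rewrite mulnK.
rewrite norm_gauss_sum_prime //.
rewrite (IH q) //; last 2 first.
- by apply: leq_trans le_nm; rewrite ltn_Pmull // prime_gt1.
- by apply: squarefree_dvd sq; rewrite ?dvdn_mull.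
have primes_pq : perm_eq (primes (p * q)) (p :: primes q).
  apply: uniq_perm => [||r]; rewrite ?primes_uniq //=.
    rewrite primes_uniq andbT mem_primes q_gt0 p_prime /=.
    by rewrite -prime_coprime.
  by rewrite primesM // primes_prime // !inE.
rewrite (perm_big _ primes_pq) big_cons -natrM; congr (_ %:R).
rewrite (ramified_crt_part n_gt0 co_pq chiP p_prime) // /ramified divnn p_gt0.
have -> : \prod_(r <- primes q | ramified q (crt_part q p chi) r) r =
          \prod_(r <- primes q | ramified (p * q) chi r) r.
  rewrite big_seq_cond [RHS]big_seq_cond; apply: eq_bigl => r.
  apply: andb_id2l; rewrite mem_primes => /and3P[r_prime _ r_q].
  by rewrite mulnC -ramified_crt_part // mulnC.
by case: ifP; rewrite ?mul1n.
Qed.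

(** * Irreducible characters of the group of units as Dirichlet characters *)

Notation dirichlet_nat i := (fun a : nat => dirichlet_char i a%:Z).

Definition unit_mod (n a : nat) : {unit 'Z_n} :=
  insubd (1%g : {unit 'Z_n}) (a%:R : 'Z_n).

Lemma dirichlet_natE n (i : Iirr (units_Zp n)) a :
  dirichlet_char i a%:Z =
    if coprime a n then 'chi_i (unit_mod n a) else 0.
Proof. by rewrite /dirichlet_char /coprimez -pmulrn. Qed.

Lemma val_unit_mod n a : (1 < n)%N -> coprime a n -> val (unit_mod n a) = a%:R.
Proof.
by move=> n_gt1 co_an; rewrite /unit_mod val_insubd unitZpE // coprime_sym co_an.
Qed.

Lemma unit_modM n a b : (1 < n)%N -> coprime a n -> coprime b n ->
  unit_mod n (a * b) = (unit_mod n a * unit_mod n b)%g.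
Proof.
move=> n_gt1 co_an co_bn; apply: val_inj.
by rewrite FinRing.val_unitM !val_unit_mod ?coprimeMl ?co_an // natrM.
Qed.

Lemma eq_unit_mod n a b : (1 < n)%N -> a = b %[mod n] -> unit_mod n a = unit_mod n b.
Proof.
move=> n_gt1 ab; rewrite /unit_mod; congr insubd.
by apply: val_inj; rewrite /= !val_Zp_nat.
Qed.

Lemma unit_mod1 n : unit_mod n 1 = 1%g.
Proof. by apply: val_inj; rewrite /unit_mod val_insubd unitr1. Qed.

Lemma unit_mod_surj n (u : {unit 'Z_n}) : (1 < n)%N ->
  coprime (val u : 'Z_n) n /\ unit_mod n (val u : 'Z_n) = u.
Proof.
move=> n_gt1; have uE : ((val u : 'Z_n) : nat)%:R = val u :> 'Z_n by rewrite natr_Zp.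
have co : coprime (val u : 'Z_n) n by rewrite coprime_sym -unitZpE // uE (valP u).
by split=> //; apply: val_inj; rewrite val_unit_mod.
Qed.

Lemma units_Zp_lin_char n (i : Iirr (units_Zp n)) : 'chi_i \is a linear_char.
Proof. by move: i; apply/char_abelianP; apply: units_Zp_abelian. Qed.

Lemma dirichlet_char_mod1 (i : Iirr (units_Zp 1)) a : dirichlet_char i a%:Z = 1.
Proof.
rewrite dirichlet_natE coprimen1.
suff -> : unit_mod 1 a = 1%g by rewrite lin_char1 // units_Zp_lin_char.
have /card1P[u uE] : #|units_Zp 1| == 1%N by rewrite card_units_Zp.
have E v : v = u by apply/eqP; have := uE v; rewrite !inE => <-.
by rewrite [LHS]E [RHS]E.
Qed.

Lemma dirichlet_charP n (i : Iirr (units_Zp n)) :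
  (0 < n)%N -> dirichlet_fun n (dirichlet_nat i).
Proof.
case: n i => // -[|n] i _.
  split=> [|a b|a|a]; rewrite ?dirichlet_char_mod1 ?mulr1 //.
  by rewrite coprimen1.
have lin := units_Zp_lin_char i; have n_gt1 : (1 < n.+2)%N by [].
split=> [|a b|a|a] /=.
- by rewrite dirichlet_natE coprime1n unit_mod1 lin_char1.
- rewrite !dirichlet_natE coprimeMl; case: ifP => [/andP[co_a co_b]|].
    by rewrite co_a co_b unit_modM // lin_charM ?inE.
  by case: (coprime a _); case: (coprime b _); rewrite ?mulr0 ?mul0r.
- rewrite !dirichlet_natE coprime_modl.
  by rewrite (eq_unit_mod n_gt1 (modn_mod a n.+2)).
- by rewrite dirichlet_natE => /negPf ->.
Qed.

(** A Dirichlet function modulo n restricts to a homomorphism on the units,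
    that is, to a one-dimensional representation of an abelian group. *)
Lemma dirichlet_char_exists n chi : (0 < n)%N -> dirichlet_fun n chi ->
  exists i : Iirr (units_Zp n), dirichlet_nat i =1 chi.
Proof.
case: n => // -[|n] _ chiP.
  exists 0 => a; rewrite dirichlet_char_mod1 -(dirichlet_fun_mod chiP) modn1.
  by rewrite -(modn1 1) (dirichlet_fun_mod chiP) (dirichlet_fun1 chiP).
have n_gt1 : (1 < n.+2)%N by [].
pose lam (u : {unit 'Z_n.+2}) : 'M[algC]_1 := (chi (val u : 'Z_n.+2))%:M.
have lamE a : coprime a n.+2 -> lam (unit_mod n.+2 a) = (chi a)%:M.
  move=> co_a; rewrite /lam val_unit_mod // val_Zp_nat //.
  by rewrite (dirichlet_fun_mod chiP).
have lam_repr : mx_repr (units_Zp n.+2) lam.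
  split=> [|u v _ _]; first by rewrite -unit_mod1 lamE ?coprime1n // (dirichlet_fun1 chiP).
  have [co_u <-] := unit_mod_surj u n_gt1; have [co_v <-] := unit_mod_surj v n_gt1.
  rewrite -unit_modM // !lamE ?coprimeMl ?co_u //.
  by rewrite (dirichlet_funM chiP) scalar_mxM.
pose rG := MxRepresentation lam_repr.
have /irrP[i iE] : cfRepr rG \in irr (units_Zp n.+2).
  by apply: lin_char_irr; rewrite qualifE /= cfRepr_char cfRepr1 eqxx.
exists i => a; rewrite dirichlet_natE; case: ifP => [co_a|/negbT co_a].
  by rewrite -iE cfunE inE /= lamE // mxtrace_scalar mulr1n.
by rewrite (dirichlet_fun0 chiP).
Qed.

(** Reindexing by u |-> val u mod n; the non-units a are sent by [unit_mod] to 1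
    and excluded because 1 is not sent back to a. *)
Lemma sum_units_Zp (V : nmodType) n (F : {unit 'Z_n} -> V) : (1 < n)%N ->
  \sum_(u in units_Zp n) F u = \sum_(a < n | coprime a n) F (unit_mod n a).
Proof.
move=> n_gt1; have n_gt0 := ltnW n_gt1.
pose g (u : {unit 'Z_n}) : 'I_n := Ordinal (ltn_pmod (val u : 'Z_n) n_gt0).
rewrite (reindex_onto (fun a : 'I_n => unit_mod n a) g) => [|u _]; last first.
  have [_ {2}<-] := unit_mod_surj u n_gt1.
  exact/eq_unit_mod/modn_mod.
apply: eq_bigl => a; rewrite inE /=; case: (boolP (coprime a n)) => [co_a|].
  by apply/eqP/val_inj; rewrite /= val_unit_mod // val_Zp_nat // modn_mod modn_small.
apply: contraNF => /eqP <-; rewrite /= coprime_modl.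
by have [] := unit_mod_surj (unit_mod n a) n_gt1.
Qed.

Lemma sum_dirichlet_orthogonal n (i j : Iirr (units_Zp n)) : (1 < n)%N ->
  \sum_(a < n) dirichlet_nat i a * (dirichlet_nat j a)^* =
    if i == j then (totient n)%:R else 0.
Proof.
move=> n_gt1; have n_gt0 := ltnW n_gt1.
have := first_orthogonality_relation i j.
rewrite card_units_Zp // => /(congr1 (fun x => (totient n)%:R * x)).
rewrite mulVKf ?pnatr_eq0 -?lt0n ?totient_gt0 // mulr_natr mulrb => <-.
rewrite sum_units_Zp // [RHS]big_mkcond /=; apply: eq_bigr => a _.
rewrite !dirichlet_natE; case: ifP => _; last by rewrite mul0r.
by rewrite irr_inv.
Qed.

(** * Conductors *)

(** If chi is trivial on the kernel of (Z/n)^* -> (Z/d)^*, then chi agrees with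
    its Chinese remainder component modulo d, as its component modulo n / d is
    trivial. *)
Lemma induced_fromP n (i : Iirr (units_Zp n)) d :
    (0 < n)%N -> squarefree n -> (d %| n)%N ->
  induced_from i d = factors_mod n (dirichlet_nat i) d.
Proof.
move=> n_gt0 sq d_n; have iP := dirichlet_charP i n_gt0.
have d_gt0 := dvdn_gt0 n_gt0 d_n.
apply/existsP/(factors_modP n_gt0 d_n (dirichlet_fun_mod iP)).
  case=> j /forallP ij a co_a a1; rewrite -(dirichlet_fun_mod iP).
  have /implyP := ij (Ordinal (ltn_pmod a n_gt0)).
  rewrite /= coprime_modl => /(_ co_a)/eqP ->.
  have jP := dirichlet_charP j d_gt0.
  rewrite -(dirichlet_fun1 jP); apply: (periodic_eqmod (dirichlet_fun_mod jP)).
  by rewrite modn_dvdm.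
move: sq n_gt0 iP; have n_de : n = (d * (n %/ d))%N by rewrite mulnC divnK.
set e := (n %/ d)%N in n_de; clearbody e; subst n => sq n_gt0 iP chi1.
have co_de := squarefree_coprime n_gt0 sq.
have co_ed : coprime e d by rewrite coprime_sym.
have [j jE] := dirichlet_char_exists d_gt0 (crt_part_dirichlet co_de iP).
exists j; apply/forallP => a; apply/implyP => co_a; rewrite [X in _ == X]jE.
rewrite [X in X == _](crt_part_split a co_de iP) [X in _ * X]chi1 ?mulr1 //.
  rewrite [X in coprime _ X]mulnC coprime_chinese //.
  by rewrite coprime1n andbT; move: co_a; rewrite coprimeMr => /andP[].
by rewrite chinese_modr.
Qed.

(** For squarefree n the group of units congruent to 1 modulo d is generated
    by the factors (Z/p)^* of (Z/n)^* for the primes p dividing n / d, so that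
    chi factors through (Z/d)^* when all its ramified primes divide d. *)
Lemma factors_mod_squarefree n chi d :
    (0 < n)%N -> squarefree n -> dirichlet_fun n chi -> (d %| n)%N ->
  factors_mod n chi d =
    (\prod_(p <- primes n | ramified n chi p) p %| d)%N.
Proof.
move=> n_gt0 sq chiP d_n; have chi_mod := dirichlet_fun_mod chiP.
apply/idP/idP => [/(factors_modP n_gt0 d_n chi_mod) chi1|].
  have all_d p : prime p -> (p %| n)%N -> ramified n chi p -> (p %| d)%N.
    move=> p_prime p_n; apply: contraR => p_d.
    apply/factors_modP => // [|a co_a a1]; first exact: dvdn_div.
    have d_np : (d %| n %/ p)%N.
      by rewrite dvdn_divRL // Gauss_dvd ?d_n // coprime_sym prime_coprime.
    by apply: chi1 => //; rewrite -(modn_dvdm _ d_np) a1 modn_dvdm.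
  have : {subset primes n <= [pred p | prime p && (p %| n)%N]}.
    by move=> p; rewrite mem_primes !inE => /and3P[-> _ ->].
  elim: (primes n) (primes_uniq n) => [|p s IH] /= => [_ _|/andP[p_s s_uniq] sub].
    by rewrite big_nil dvd1n.
  have /IH {}IH := s_uniq.
  have {}IH : (\prod_(j <- s | ramified n chi j) j %| d)%N.
    by apply: IH => r r_s; apply: sub; rewrite inE r_s orbT.
  rewrite big_cons; case: ifP => // ram_p.
  have /andP[p_prime p_n] : prime p && (p %| n)%N by apply: sub (mem_head _ _).
  rewrite Gauss_dvd ?IH ?all_d //.
  rewrite big_seq_cond; elim/big_rec: _ => [|r x /andP[r_s _] co_x]; first exact: coprimen1.
  rewrite coprimeMr co_x andbT.
  have /andP[r_prime _] : prime r && (r %| n)%N by apply: sub; rewrite inE r_s orbT.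
  rewrite prime_coprime // dvdn_prime2 //.
  by apply: contraNneq p_s => ->.
set F := \prod_(p <- _ | _) p.
have F_p p : prime p -> (p %| n)%N -> ramified n chi p -> (p %| F)%N.
  move=> p_prime p_n ram; rewrite /F (big_rem p) /= ?ram ?dvdn_mulr //.
  by rewrite mem_primes p_prime n_gt0.
(* Descending induction on d, from the trivial case d = n. *)
have [m] := ubnP (n %/ d); elim: m => // m IH in d d_n *; rewrite ltnS => le_m F_d.
have d_gt0 := dvdn_gt0 n_gt0 d_n.
have [d_eq_n|d_neq_n] := eqVneq d n.
  apply/factors_modP => // a _; rewrite d_eq_n => a1.
  by rewrite -(dirichlet_fun1 chiP); apply: (periodic_eqmod chi_mod).
have e_gt1 : (1 < n %/ d)%N.
  rewrite ltn_neqAle divn_gt0 // dvdn_leq // andbT.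
  by apply: contraNneq d_neq_n => e1; rewrite -(divnK d_n) -e1 mul1n.
pose p := pdiv (n %/ d).
have p_prime : prime p by apply: pdiv_prime.
have p_e : (p %| n %/ d)%N by apply: pdiv_dvd.
have dp_n : (d * p %| n)%N by rewrite -(divnK d_n) mulnC dvdn_pmul2r.
have p_n : (p %| n)%N by apply: dvdn_trans dp_n; rewrite dvdn_mull.
have d_np : (d %| n %/ p)%N by rewrite dvdn_divRL.
have np_p : (n = n %/ p * p)%N by rewrite divnK.
have co_np : coprime (n %/ p) p by apply: squarefree_coprime; rewrite -np_p.
have co_dp : coprime d p by apply: coprime_dvdl co_np.
clearbody p.
have unram : factors_mod n chi (n %/ p).
  apply: contraLR co_dp => ram; rewrite coprime_sym prime_coprime // negbK.
  by apply: dvdn_trans F_d; apply: F_p.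
have {}IH : factors_mod n chi (d * p).
  apply: IH => //; last by rewrite dvdn_mulr.
  apply: leq_trans le_m; rewrite divnMA ltn_Pdiv ?prime_gt1 //.
  by rewrite ltnW.
apply/factors_modP => // a co_a a1.
(* a is the product of a unit that is 1 modulo d p and one that is 1 modulo
   n / p. *)
have co_ap : coprime a (n %/ p) && coprime a p by rewrite -coprimeMr -np_p.
have [co_a1 co_a2] := andP co_ap.
have co_pn : coprime p (n %/ p) by rewrite coprime_sym.
have chiP' : dirichlet_fun (n %/ p * p) chi by rewrite -np_p.
rewrite (crt_part_split a co_np chiP').
have -> : crt_part (n %/ p) p chi a = 1.
  apply: (factors_modP n_gt0 dp_n chi_mod IH).
    by rewrite [X in coprime _ X]np_p coprime_chinese // co_a1 coprime1n.
  apply/eqP; rewrite chinese_remainder // (chinese_modr co_np) eqxx andbT.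
  by rewrite -a1 -(modn_dvdm _ d_np) (chinese_modl co_np) modn_dvdm.
rewrite mul1r; apply: (factors_modP n_gt0 (dvdn_div p_n) chi_mod unram).
  by rewrite [X in coprime _ X]np_p mulnC coprime_chinese // co_a2 coprime1n.
by rewrite chinese_modr.
Qed.

(** By [factors_mod_squarefree] the divisors d of n from which the character is
    induced are exactly the multiples of the product F of its ramified primes,
    and F comes first in the sorted list of these. *)
Lemma conductor_squarefree n (i : Iirr (units_Zp n)) : (0 < n)%N -> squarefree n ->
  conductor i =
    (\prod_(p <- primes n | ramified n (dirichlet_nat i) p) p)%N.
Proof.
move=> n_gt0 sq; set F := \prod_(p <- _ | _) p.
have iP := dirichlet_charP i n_gt0.
have indE d : (d %| n)%N -> induced_from i d = (F %| d)%N.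
  by move=> d_n; rewrite induced_fromP // factors_mod_squarefree.
have F_n : (F %| n)%N.
  rewrite -indE // induced_fromP //; apply/factors_modP => //.
    exact: dirichlet_fun_mod iP.
  move=> a _ a1; rewrite -(dirichlet_fun1 iP).
  exact: (periodic_eqmod (dirichlet_fun_mod iP)).
rewrite /conductor.
have := sorted_filter leq_trans (induced_from i) (sorted_divisors n).
have : all (leq F) [seq d <- divisors n | induced_from i d].
  apply/allP => d; rewrite mem_filter -dvdn_divisors // => /andP[+ d_n].
  by rewrite indE //; apply: dvdn_leq; apply: dvdn_gt0 d_n.
have : F \in [seq d <- divisors n | induced_from i d].
  by rewrite mem_filter -dvdn_divisors // F_n andbT indE.
case: [seq d <- _ | _] => //= d s + /andP[F_d _] d_sorted.
rewrite inE => /predU1P[-> //|F_s]; apply/eqP; rewrite eqn_leq F_d andbT.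
by have := order_path_min leq_trans d_sorted => /allP/(_ F F_s).
Qed.

(** * Representatives of the units up to sign *)

(** The representatives are used only to fold sums over the units, and folding
    the sum of an indicator function recovers the usual definition. *)
Definition half_system (m r : nat) (s : 'I_r -> nat) : Prop :=
  (forall i, (s i < m)%N && coprime (s i) m) /\
  (forall (V : nmodType) (h : nat -> V),
    \sum_(a < m | coprime a m) h a = \sum_(i < r) (h (s i) + h (m - s i)%N)).

Lemma coprime_complement a m : (a <= m)%N -> coprime (m - a) m = coprime a m.
Proof.
move=> /subnKC <-; move: (m - a)%N => b.
by rewrite addKn /coprime gcdnDr gcdnDl gcdnC.
Qed.

(** A predicate P that holds for exactly one of a and m - a selects
    representatives of the units up to sign. *)
Lemma sum_half_units (V : nmodType) m (P : pred nat) (h : nat -> V) : (1 < m)%N ->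
    (forall a, (0 < a < m)%N -> coprime a m -> P (m - a)%N = ~~ P a) ->
  \sum_(a < m | coprime a m) h a =
    \sum_(a < m | coprime a m && P a) (h a + h (m - a)%N).
Proof.
move=> m_gt1 PN; rewrite (bigID (fun a : 'I_m => P a)) /= big_split /=; congr (_ + _).
have m_gt0 := ltnW m_gt1.
have ltN (a : 'I_m) : ((if a == 0 :> nat then 0 else m - a) < m)%N.
  by case: eqP => // /eqP; rewrite -lt0n => a_gt0; rewrite ltn_subrL a_gt0.
pose f a : 'I_m := Ordinal (ltN a).
have fK : involutive f.
  move=> a; apply: val_inj; rewrite /=; case: (eqVneq (a : nat) 0%N) => [->|a_neq0] //=.
  by rewrite subn_eq0 leqNgt ltn_ord /= subKn // ltnW.
have co_gt0 (a : 'I_m) : coprime a m -> (0 < a < m)%N.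
  rewrite ltn_ord andbT lt0n; apply: contraTneq => ->.
  by rewrite /coprime gcd0n neq_ltn m_gt1 orbT.
rewrite (reindex_inj (inv_inj fK)) /=; apply: eq_big => a; last first.
  move=> /andP[co_a Pa]; case: eqP => // a0.
  by move: Pa; rewrite a0 /= in co_a *; have := co_gt0 a; rewrite a0 => /(_ co_a).
case: (eqVneq (a : nat) 0%N) => [a0|a_neq0].
  have /negPf -> : ~~ coprime 0 m by rewrite /coprime gcd0n neq_ltn m_gt1 orbT.
  by rewrite a0 /coprime gcd0n gtn_eqF.
rewrite coprime_complement ?(ltnW (ltn_ord a)) //; apply: andb_id2l => co_a.
by rewrite PN ?co_gt0 // negbK.
Qed.

Lemma half_system_S_set n : (2 < n)%N -> half_system n (@S_val n).
Proof.
move=> n_gt2; split=> [j|V h].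
  have := enum_valP j; rewrite inE => /and3P[_ _ ->].
  by rewrite ltn_ord.
rewrite (@sum_half_units _ n (fun a => 2 * a < n)%N) 1?ltnW // => [|a /andP[a_gt0 a_n] co_a].
  rewrite -(big_enum_val (fun a : 'I_n => h a + h (n - a)%N)) /=.
  apply: eq_bigl => a; rewrite inE; apply/andP/and3P => [[co_a lt_a]|[_ lt_a co_a]] //.
  split=> //; rewrite lt0n; apply: contraTneq co_a => ->.
  by rewrite /coprime gcd0n; lia.
(* 2 a = n is impossible, as a and n are coprime and n > 2. *)
have : (2 * a != n)%N.
  apply: contraTneq co_a => n_2a; rewrite /coprime -n_2a gcdnMl; lia.
lia.
Qed.

(** Modulo an odd m, one of a and m - a is odd, so the odd residues less than m
    are representatives too. *)
Lemma half_system_S_set_double m : odd m -> (2 < m)%N ->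
  half_system m (@S_val (2 * m)) /\ forall j, odd (@S_val (2 * m) j).
Proof.
move=> m_odd m_gt2; have m_gt0 : (0 < m)%N by lia.
have S_E (a : 'I_(2 * m)) :
    (a \in S_set (2 * m)) = (coprime a m && odd a) && (a < m)%N.
  rewrite inE ltn_pmul2l // coprimeMr coprimen2.
  apply/and3P/andP => [[_ lt_a /andP[-> ->]]|[/andP[co_a a_odd] lt_a]] //.
  by rewrite a_odd co_a lt0n; split=> //; apply: contraTneq a_odd => ->.
split=> [|j]; last by have := enum_valP j; rewrite S_E => /andP[/andP[_ ->]].
split=> [j|V h]; first by have := enum_valP j; rewrite S_E => /andP[/andP[-> _] ->].
rewrite (@sum_half_units _ m odd) 1?ltnW // => [|a /andP[a_gt0 a_m] co_a]; last first.
  by rewrite oddB 1?ltnW // m_odd.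
rewrite -(big_enum_val (fun a : 'I_(2 * m) => h a + h (m - a)%N)) /=.
rewrite (big_ord_widen_cond (2 * m) (fun a => coprime a m && odd a)
  (fun a => h a + h (m - a)%N)) ?leq_pmull //.
by apply: eq_bigl => a; rewrite S_E.
Qed.

(** * The determinant as a product of Gauss sums *)

(** At z = exp(2 i pi / m) the entries are 2i sin(2 pi s_j s_k / m); the
    exponent (m - 1) s_j s_k stands for - s_j s_k, so that the matrix makes
    sense in any ring. *)
Definition sine_mx (F : comNzRingType) (m r : nat) (s : 'I_r -> nat) (z : F) : 'M[F]_r :=
  \matrix_(j, k) (z ^+ (s j * s k) - z ^+ (m.-1 * (s j * s k))).

Lemma map_sine_mx (F F' : comNzRingType) (f : {rmorphism F -> F'}) m r
    (s : 'I_r -> nat) z :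
  map_mx f (sine_mx m s z) = sine_mx m s (f z).
Proof. by apply/matrixP => j k; rewrite !mxE rmorphB !rmorphXn. Qed.

Lemma expr_pred_order (F : fieldType) m (z : F) a :
  (0 < m)%N -> z ^+ m = 1 -> z ^+ (m.-1 * a) = z ^- a.
Proof.
move=> m_gt0 zm; have z_neq0 := unity_root_neq0 m_gt0 zm.
apply: (mulIf (expf_neq0 a z_neq0)); rewrite mulVf ?expf_neq0 //.
rewrite -exprD addnC -mulSn prednK //.
by rewrite exprM zm expr1n.
Qed.

Lemma dirichlet_charN1 n (i : Iirr (units_Zp n)) : (1 < n)%N ->
  dirichlet_char i (- 1) = dirichlet_char i n.-1%:Z.
Proof.
move=> n_gt1; rewrite dirichlet_natE -{1}subn1 coprime_complement 1?ltnW // coprime1n.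
rewrite /dirichlet_char coprimezE abszN coprime1n /unit_mod; congr ('chi_i (insubd _ _)).
by rewrite -subn1 natrB 1?ltnW // pchar_Zp // sub0r rmorphN1.
Qed.

Lemma dirichlet_fun_opp n chi a : (a <= n)%N -> (0 < n)%N -> dirichlet_fun n chi ->
  chi (n - a)%N = chi n.-1 * chi a.
Proof.
move=> le_an n_gt0 chiP; rewrite -(dirichlet_funM chiP).
apply: (periodic_eqmod (dirichlet_fun_mod chiP)); apply/eqP.
rewrite -(eqn_modDr a) subnK // -mulSnr prednK // mulnC modnMl modnn //.
Qed.

(** Every character has the value 1 or - 1 at the unit - 1, and the sum of these
    values over all the characters is 0 by orthogonality, as - 1 <> 1. *)
Lemma card_odd_char n : (2 < n)%N ->
  #|[set i : Iirr (units_Zp n) | odd_char i]|.*2 = totient n.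
Proof.
move=> n_gt2; have n_gt0 : (0 < n)%N by lia.
have n_gt1 : (1 < n)%N by lia.
pose x := unit_mod n n.-1.
have co_x : coprime n.-1 n by rewrite -subn1 coprime_complement // coprime1n.
have chi_x (i : Iirr (units_Zp n)) : 'chi_i x = if odd_char i then -1 else 1.
  have iP := dirichlet_charP i n_gt0.
  have E : 'chi_i x = dirichlet_char i n.-1%:Z by rewrite dirichlet_natE co_x.
  rewrite /odd_char dirichlet_charN1 // E; case: eqP => // /eqP neqN1.
  apply/eqP; move: neqN1; apply: contraNT => neq1.
  have : dirichlet_char i n.-1%:Z ^+ 2 == 1.
    rewrite expr2 -[X in X == _](dirichlet_fun_opp (leq_pred n) n_gt0 iP).
    by rewrite (_ : n - n.-1 = 1)%N ?(dirichlet_fun1 iP) //; lia.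
  by rewrite -{1}(expr1n _ 2) eqf_sqr (negPf neq1).
have x1 : x \notin (1 ^: units_Zp n)%g.
  rewrite class1G inE -(unit_mod1 n); apply/eqP => /(congr1 val).
  rewrite !val_unit_mod ?coprime1n // => /(congr1 val) /=.
  by rewrite !val_Zp_nat // !modn_small //; lia.
have := second_orthogonality_relation x (group1 (units_Zp n)).
rewrite (negPf x1) mulr0n.
move=> sum_chi; apply/eqP; rewrite -(eqr_nat algC).
have <- : \sum_(i : Iirr (units_Zp n)) (1 - 'chi_i x * ('chi_i 1%g)^* ) = (totient n)%:R.
  rewrite big_split /= sumrN sum_chi oppr0 addr0 sumr_const.
  by rewrite card_Iirr_abelian ?units_Zp_abelian // card_units_Zp.
rewrite -muln2 natrM mulr_natl -sumr_const big_mkcond; apply/eqP/eq_bigr => i _.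
rewrite lin_char1 ?units_Zp_lin_char // rmorph1 mulr1 chi_x inE.
by case: ifP; rewrite ?subrr // opprK.
Qed.

Lemma half_system_card m r (s : 'I_r -> nat) : half_system m s -> r.*2 = totient m.
Proof.
case=> _ /(_ nat (fun=> 1%N)); rewrite [X in _ = X -> _]sum_nat_const card_ord -muln2 => <-.
rewrite totient_count_coprime big_mkord big_mkcond; apply: eq_bigr => a _.
by rewrite coprime_sym; case: coprime.
Qed.

(** For odd chi, a and m - a contribute
    chi(a) z^(ak) - chi(a) z^(-ak) together to the Gauss sum at z^k. *)
Lemma gauss_sum_half_system m r (s : 'I_r -> nat) chi z k :
    (0 < m)%N -> half_system m s -> dirichlet_fun m chi -> chi m.-1 = -1 ->
    z ^+ m = 1 -> coprime k m ->
  \sum_j chi (s j) * (z ^+ (s j * k) - z ^+ (m.-1 * (s j * k))) =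
    (chi k)^* * gauss_sum m chi z.
Proof.
move=> m_gt0 [sP s_sum] chiP chiN1 zm co_k.
rewrite -gauss_sum_expr // /gauss_sum.
transitivity (\sum_(a < m | coprime a m) chi a * (z ^+ k) ^+ a); last first.
  rewrite big_mkcond; apply: eq_bigr => a _; case: ifPn => // co_a.
  by rewrite (dirichlet_fun0 chiP co_a) mul0r.
rewrite (s_sum algC (fun a => chi a * (z ^+ k) ^+ a)); apply: eq_bigr => j _.
have /andP[/ltnW le_s _] := sP j.
rewrite (dirichlet_fun_opp le_s m_gt0 chiP) chiN1 mulN1r mulrBr mulNr -!exprM.
congr (_ * z ^+ _ - _ * _); first by rewrite mulnC.
rewrite (expr_pred_order _ m_gt0 zm).
have z_neq0 := unity_root_neq0 m_gt0 zm.
apply: (mulIf (expf_neq0 (s j * k) z_neq0)); rewrite mulVf ?expf_neq0 // -exprD.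
by rewrite mulnC -mulnDl subnK // exprM zm expr1n.
Qed.

(** The matrix X of the values of the odd characters at the representatives
    satisfies X X^* = (phi(m) / 2) I, by orthogonality, and X A = D X^bar with D
    the diagonal matrix of the Gauss sums; take determinants. *)
Lemma norm_det_sine_mx m r (s : 'I_r -> nat) z :
    (2 < m)%N -> half_system m s -> m.-primitive_root z ->
  `|\det (sine_mx m s z)| =
    \prod_(i : Iirr (units_Zp m) | odd_char i) `|gauss_sum m (dirichlet_nat i) z|.
Proof.
move=> m_gt2 sH z_prim; have m_gt0 := prim_order_gt0 z_prim.
have m_gt1 := ltnW m_gt2; have zm := prim_expr_order z_prim.
set O := [set i : Iirr (units_Zp m) | odd_char i].
have r_O : r = #|O|.
  by apply: double_inj; rewrite (half_system_card sH) card_odd_char.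
subst r; pose chi (k : 'I_#|O|) := dirichlet_nat (enum_val k).
have chiP k : dirichlet_fun m (chi k) by apply: dirichlet_charP.
have chiN1 k : chi k m.-1 = -1.
  have := enum_valP k; rewrite inE /odd_char dirichlet_charN1 // => /eqP.
  exact.
pose X : 'M[algC]_#|O| := \matrix_(k, j) chi k (s j).
pose D : 'M[algC]_#|O| := diag_mx (\row_k gauss_sum m (chi k) z).
have XA : X *m sine_mx m s z = D *m map_mx Num.conj X.
  apply/matrixP => k l; rewrite mul_diag_mx !mxE mulrC.
  have [sP _] := sH; have /andP[_ co_l] := sP l.
  rewrite -(gauss_sum_half_system m_gt0 sH (chiP k) (chiN1 k) zm co_l).
  by apply: eq_bigr => j _; rewrite !mxE.
have XX : X *m (map_mx Num.conj X)^T *+ 2 = (totient m)%:R%:M.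
  apply/matrixP => k l; rewrite mulmxnE !mxE -(inj_eq enum_val_inj).
  rewrite mulrb -(sum_dirichlet_orthogonal (enum_val k) (enum_val l) m_gt1).
  have [sP s_sum] := sH; pose h a := chi k a * (chi l a)^*.
  transitivity (\sum_(a < m | coprime a m) h a); last first.
    rewrite big_mkcond; apply: eq_bigr => a _; case: ifPn => // co_a.
    by rewrite [X in X * _](dirichlet_fun0 (chiP k) co_a) mul0r.
  rewrite s_sum -sumrMnl; apply: eq_bigr => j _; rewrite !mxE mulr2n.
  have /andP[/ltnW le_s _] := sP j; rewrite /h.
  rewrite (dirichlet_fun_opp le_s m_gt0 (chiP k)) (dirichlet_fun_opp le_s m_gt0 (chiP l)).
  by rewrite !chiN1 !mulN1r rmorphN mulrNN.
have detX : \det X != 0.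
  have phi_neq0 : (totient m)%:R != 0 :> algC by rewrite pnatr_eq0 -lt0n totient_gt0.
  have /eqP := congr1 determinant XX; rewrite -scaler_nat detZ det_mulmx det_scalar.
  apply: contraTneq => ->; rewrite mul0r mulr0 eq_sym.
  by rewrite expf_neq0.
have := congr1 (fun M => `|\det M|) XA.
rewrite !det_mulmx det_map_mx det_diag !normrM norm_conjC mulrC.
move/(mulIf _) => ->; last by rewrite normr_eq0.
rewrite normr_prod [LHS](eq_bigr (fun k => `|gauss_sum m (chi k) z|)); last first.
  by move=> k _; rewrite mxE.
rewrite -(big_enum_val (fun i => `|gauss_sum m (dirichlet_nat i) z|)).
by apply: eq_bigl => i; rewrite inE.
Qed.

(** Conjugation changes the sign of the matrix, so that the squared norm of its
    determinant is, up to sign, the square of that determinant: a polynomial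
    identity in z with integer coefficients. *)
Lemma sqr_det_sine_mx m r (s : 'I_r -> nat) (z : algC) :
    (2 < m)%N -> squarefree m -> half_system m s -> m.-primitive_root z ->
  (-1) ^+ r * \det (sine_mx m s z) ^+ 2 =
    (\prod_(i : Iirr (units_Zp m) | odd_char i) conductor i)%:R.
Proof.
move=> m_gt2 sq sH z_prim; have m_gt0 := prim_order_gt0 z_prim.
have zm := prim_expr_order z_prim; have z_conj := conj_unity_root m_gt0 zm.
have AN : map_mx Num.conj (sine_mx m s z) = - sine_mx m s z.
  apply/matrixP => j k; rewrite !mxE rmorphB !rmorphXn /= z_conj opprB.
  rewrite !(expr_pred_order _ m_gt0) ?exprVn ?zm ?invr1 //.
  by rewrite invrK.
transitivity (`|\det (sine_mx m s z)| ^+ 2).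
  by rewrite normCK -det_map_mx AN -scaleN1r detZ expr2 [RHS]mulrCA.
rewrite norm_det_sine_mx // -prodrXl natr_prod; apply: eq_bigr => i _.
rewrite (norm_gauss_sum_squarefree sq (dirichlet_charP i m_gt0) z_prim).
by rewrite conductor_squarefree.
Qed.

(** * Changing the root of unity *)

(** A polynomial identity with integer coefficients that holds at one primitive
    n-th root of unity in algC holds at all primitive n-th roots of unity, in
    any numeric field: the n-th cyclotomic polynomial is a minimal polynomial
    over the rationals, so it divides P. *)
Lemma root_prim_root_transfer (F : numFieldType) n (z : algC) (w : F) (P : {poly int}) :
    n.-primitive_root z -> n.-primitive_root w ->
  root (map_poly intr P) z -> root (map_poly intr P) w.
Proof.
move=> z_prim w_prim Pz; have n_gt0 := prim_order_gt0 w_prim.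
have eval_Phi d : (0 < d)%N ->
    w ^+ d - 1 = \prod_(e <- divisors d) (map_poly intr 'Phi_e).[w].
  move=> d_gt0; rewrite -horner_prod -rmorph_prod /= prod_Cyclotomic //.
  by rewrite rmorphB rmorph1 /= map_polyXn !hornerE.
have w_Phi : root (map_poly intr 'Phi_n) w.
  have /eqP := eval_Phi n n_gt0; rewrite prim_expr_order // subrr eq_sym.
  rewrite prodf_seq_eq0 => /hasP[d d_n /= Phi_d].
  have d_gt0 : (0 < d)%N by move: d_n; rewrite -dvdn_divisors // => /(dvdn_gt0 n_gt0).
  suff -> : n = d by [].
  apply/eqP; rewrite eqn_dvd [(d %| n)%N]dvdn_divisors // d_n andbT.
  rewrite (prim_order_dvd w_prim) -subr_eq0 eval_Phi // (big_rem d) /=.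
    by rewrite (eqP Phi_d) mul0r.
  by rewrite -dvdn_divisors.
have ZtoQ (K : numFieldType) (Q : {poly int}) :
    map_poly (ratr : rat -> K) (map_poly intr Q) = map_poly intr Q.
  by rewrite -map_poly_comp; apply: eq_map_poly => a /=; rewrite ratr_int.
have [q [q_min _] q_dvd] := minCpolyP z.
have q_Phi : q = map_poly intr 'Phi_n.
  apply: (map_poly_inj (ratr : {rmorphism rat -> algC})).
  by rewrite /= -q_min (minCpoly_cyclotomic z_prim) -(Cintr_Cyclotomic z_prim) ZtoQ.
have : q %| map_poly intr P by rewrite -q_dvd ZtoQ.
rewrite q_Phi -(dvdp_map (ratr : {rmorphism rat -> F})) /= !ZtoQ => Phi_P.
exact: root_dvdp Phi_P w_Phi.
Qed.

(** * Vanishing when n has a square factor *)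

(** The shift of a by d permutes the terms, but it also multiplies the sum by
    y^d, which is not 1. *)
Lemma sum_progression_unity (F : fieldType) n d c (y : F) :
    (0 < n)%N -> (d %| n)%N -> y ^+ n = 1 -> y ^+ d != 1 ->
  \sum_(a < n | (a == c %[mod d])%N) y ^+ a = 0.
Proof.
move=> n_gt0 d_n yn yd; pose h a := if (a == c %[mod d])%N then y ^+ a else 0.
have hP : periodic n h.
  by move=> a; rewrite /h (modn_dvdm _ d_n) (periodic_expr yn).
rewrite big_mkcond; have := sum_periodic_shift d n_gt0 hP.
rewrite (eq_bigr (fun a : 'I_n => y ^+ d * h a)) => [|a _]; last first.
  rewrite /h modnDr; case: ifP => _; last by rewrite mulr0.
  by rewrite exprD mulrC.
rewrite -mulr_sumr => /eqP; rewrite -subr_eq0 -[X in _ - X]mul1r -mulrBl mulf_eq0.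
by rewrite subr_eq0 (negPf yd) => /eqP.
Qed.

(** If p^2 divides n then the units congruent to c modulo d = n / p are a full
    arithmetic progression, over which the entries of a column add up to 0.
    This is a linear relation between the rows; it is trivial only when c and
    - c are congruent modulo d, that is, when d = 2. *)
Lemma det_sine_mx_eq0 (F : fieldType) p d r (s : 'I_r -> nat) (z : F) :
    prime p -> (p %| d)%N -> (2 < d)%N -> half_system (p * d) s ->
    (p * d).-primitive_root z ->
  \det (sine_mx (p * d) s z) = 0.
Proof.
move=> p_prime p_d d_gt2 sH z_prim; set n := (p * d)%N in sH z_prim *.
have n_gt0 := prim_order_gt0 z_prim; have zn := prim_expr_order z_prim.
have d_n : (d %| n)%N by rewrite dvdn_mull.
have d_lt_n : (d < n)%N by rewrite ltn_Pmull ?prime_gt1 //; lia.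
have r_gt0 : (0 < r)%N.
  by rewrite -double_gt0 (half_system_card sH) totient_gt0.
have [sP s_sum] := sH; pose j0 := Ordinal r_gt0; pose c := s j0.
have /andP[c_n co_c] := sP j0.
have co_cd : coprime c d by apply: coprime_dvdr co_c.
apply/eqP/det0P.
(* The relation between the rows: the units congruent to c = s j0 modulo d,
   folded to the representatives s j. *)
exists (\row_j ((s j == c %[mod d])%N%:R - (n - s j == c %[mod d])%N%:R)).
  apply/eqP => /rowP/(_ j0)/eqP; rewrite !mxE eqxx subr_eq0 => /eqP.
  case: eqP => [e|_] /eqP; last by rewrite oner_eq0.
  have : (d %| 2)%N.
    rewrite -(@Gauss_dvdr d c) 1?coprime_sym // mulnC mul2n -addnn.
    rewrite /dvdn -modnDml -e modnDml subnK 1?ltnW //.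
  by move=> /(dvdn_leq (ltn0Sn 1)); lia.
apply/rowP => k; rewrite !mxE.
have /andP[_ co_k] := sP k.
pose g a := z ^+ (a * s k) - z ^+ (n.-1 * (a * s k)).
transitivity (\sum_(a < n | coprime a n) (if (a == c %[mod d])%N then g a else 0)).
  rewrite (s_sum F (fun a => if (a == c %[mod d])%N then g a else 0)).
  apply: eq_bigr => j _; rewrite !mxE mulrBl -/(g (s j)); congr (_ + _).
    by case: eqP; rewrite ?mul1r ?mul0r.
  have /andP[/ltnW le_s _] := sP j.
  have -> : g (n - s j)%N = - g (s j).
    have z_neq0 := unity_root_neq0 n_gt0 zn.
    have E : z ^+ ((n - s j) * s k) = z ^- (s j * s k).
      apply: (mulIf (expf_neq0 (s j * s k) z_neq0)); rewrite mulVf ?expf_neq0 //.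
      by rewrite -exprD -mulnDl subnK // exprM zn expr1n.
    by rewrite /g !(expr_pred_order _ n_gt0 zn) E invrK opprB.
  by case: eqP; rewrite ?mul1r ?mul0r ?oppr0.
rewrite -big_mkcondr (eq_bigl (fun a : 'I_n => (a == c %[mod d])%N)) => [|a]; last first.
  apply: andb_idl => /eqP a_c; have co_ad : coprime a d.
    by rewrite -coprime_modl a_c coprime_modl.
  by rewrite coprimeMr co_ad andbT (coprime_dvdr p_d).
have sum0 k' : coprime k' n -> \sum_(a < n | (a == c %[mod d])%N) z ^+ (k' * a) = 0.
  move=> co_k'; under eq_bigr do rewrite exprM.
  apply: sum_progression_unity => //; first by rewrite -exprM mulnC exprM zn expr1n.
  rewrite -exprM -(prim_order_dvd z_prim) Gauss_dvdr 1?coprime_sym //.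
  by apply/negP => /dvdn_leq; lia.
rewrite /g sumrB -[RHS](subrr 0); congr (_ - _).
  by rewrite -[RHS](sum0 (s k) co_k); apply: eq_bigr => a _; rewrite mulnC.
rewrite -[RHS](sum0 (n.-1 * s k)%N); first by apply: eq_bigr => a _; rewrite -mulnA (mulnC (s k)).
by rewrite coprimeMl co_k andbT -subn1 coprime_complement // coprime1n.
Qed.

(** * Sines and roots of unity in R[i] *)

Section Cis.

Variable R : realType.
Implicit Types t u : R.

Definition cis t : R[i] := Complex (cos t) (sin t).

Lemma cisD t u : cis (t + u) = cis t * cis u.
Proof. by apply/eqP; rewrite eq_complex /= cosD sinD eqxx /= addrC. Qed.

Lemma cisMn t n : cis (t *+ n) = cis t ^+ n.
Proof.
elim: n => [|n IH]; first by rewrite mulr0n expr0 /cis cos0 sin0.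
by rewrite mulrS exprS cisD IH.
Qed.

Lemma cisN t : cis (- t) = (cis t)^-1.
Proof.
have cisK : cis (- t) * cis t = 1 by rewrite -cisD addNr /cis cos0 sin0.
have cis_neq0 : cis t != 0.
  by apply/eqP => c0; move/eqP: cisK; rewrite c0 mulr0 eq_sym oner_eq0.
by apply: (mulIf cis_neq0); rewrite cisK mulVf.
Qed.

Lemma sub_cis t : cis t - cis (- t) = 2 * 'i%C * (sin t)%:C%C.
Proof.
apply/eqP; rewrite eq_complex /= cosN sinN; apply/andP; split; apply/eqP; ring.
Qed.

Lemma cis_prim_root n : (0 < n)%N -> n.-primitive_root (cis (2 * pi / n%:R)).
Proof.
move=> n_gt0; have nR_gt0 : 0 < n%:R :> R by rewrite ltr0n.
have cis_n : cis (2 * pi / n%:R) ^+ n = 1.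
  rewrite -cisMn -[_ / _ *+ n]mulr_natr divfK ?gt_eqF // mulrC mulr_natr.
  by rewrite /cis cos2pi sin2pi.
have [m m_prim m_n] := prim_order_exists n_gt0 cis_n.
have [m_eq_n|m_neq_n] := eqVneq m n; first by rewrite -{1}m_eq_n.
have m_gt0 := prim_order_gt0 m_prim.
have m_lt_n : (m < n)%N by rewrite ltn_neqAle m_neq_n dvdn_leq.
have := prim_expr_order m_prim; rewrite -cisMn => /(congr1 (@complex.Re R)) /=.
have -> : 2 * pi / n%:R *+ m = (pi * (m%:R / n%:R)) *+ 2 :> R.
  by rewrite -[LHS]mulr_natr -[RHS]mulr_natr; ring.
rewrite cos_mulr2n cos2sin2 => e.
have : 0 < sin (pi * (m%:R / n%:R) : R).
  apply: sin_gt0_pi; rewrite mulr_gt0 ?pi_gt0 ?divr_gt0 ?ltr0n //=.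
  by rewrite gtr_pMr ?pi_gt0 // ltr_pdivrMr // mul1r ltr_nat.
move: (sin _) e => x e x_gt0; have : x ^+ 2 = 0 by lra.
by move/eqP; rewrite sqrf_eq0 gt_eqF.
Qed.

End Cis.

(** * The determinant of the matrix of sines *)

Lemma sqrt_prod (R : rcfType) (I : Type) (l : seq I) (P : pred I) (F : I -> nat) :
  Num.sqrt (\prod_(i <- l | P i) F i)%:R =
    \prod_(i <- l | P i) Num.sqrt (F i)%:R :> R.
Proof.
rewrite natr_prod; elim/big_rec2: _ => [|i x y _ <-]; first by rewrite sqrtr1.
by rewrite sqrtrM ?ler0n.
Qed.

(** The value of the determinant passes from algC to R[i], where the sine matrix
    has the entries c sin with c = 2i or c = - 2i. *)
Lemma abs_det_half_system (R : realType) m r (s : 'I_r -> nat) (B : 'M[R]_r)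
    (c z : R[i]) :
    (2 < m)%N -> squarefree m -> half_system m s -> m.-primitive_root z ->
    c ^+ 2 = - 4 -> c *: map_mx (real_complex R) B = sine_mx m s z ->
  `|\det B| = 2 `^ (- ((totient m)%:R / 2)) *
    \prod_(i : Iirr (units_Zp m) | odd_char i) Num.sqrt (conductor i)%:R.
Proof.
move=> m_gt2 sq sH z_prim c2 cB; have m_gt0 := prim_order_gt0 z_prim.
set N := (\prod_(i : Iirr (units_Zp m) | odd_char i) conductor i)%N.
pose P : {poly int} := (-1) ^+ r * \det (sine_mx m s 'X) ^+ 2 - N%:R.
have P_eval (F : numFieldType) (y : F) :
    (map_poly intr P).[y] = (-1) ^+ r * \det (sine_mx m s y) ^+ 2 - N%:R.
  pose f : {rmorphism {poly int} -> F} := (horner_eval y \o map_poly intr).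
  rewrite -[LHS]/(f P) rmorphB rmorphM !rmorphXn rmorphN1 rmorph_nat.
  rewrite -det_map_mx map_sine_mx.
  by rewrite (_ : f 'X = y) //= map_polyX /horner_eval hornerX.
have [z0 z0_prim] := C_prim_root_exists m_gt0.
have Pz : root (map_poly intr P) z.
  apply: (root_prim_root_transfer z0_prim z_prim).
  by rewrite rootE P_eval sqr_det_sine_mx // subrr.
have {Pz} detB : 4 ^+ r * \det B ^+ 2 = N%:R.
  apply: (@complexI R); rewrite rmorphM !rmorphXn /= !rmorph_nat -det_map_mx.
  move: Pz; rewrite rootE P_eval subr_eq0 -cB detZ => /eqP <-.
  by rewrite exprMn -exprM mulnC exprM c2 [RHS]mulrA -exprMn mulN1r opprK.
have N_E : N%:R = (2 ^+ r * `|\det B|) ^+ 2.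
  rewrite exprMn real_normK ?num_real // -detB; congr (_ * _).
  by rewrite -exprM mulnC exprM (_ : 2 ^+ 2 = 4 :> R) //; ring.
rewrite -sqrt_prod -/N N_E sqrtr_sqr normrM normr_id [`|2 ^+ r|]ger0_norm ?exprn_ge0 //.
rewrite -(half_system_card sH) -muln2 natrM mulfK ?pnatr_eq0 // powR_invn // mulKf //.
by rewrite expf_neq0 ?pnatr_eq0.
Qed.

Lemma sin_mxE (R : realType) n (z := cis (2 * pi / n%:R : R)) j k :
  (0 < n)%N ->
  2 * 'i%C * (sin_mx R n j k)%:C%C =
    z ^+ (S_val j * S_val k) - z ^- (S_val j * S_val k).
Proof.
move=> n_gt0; rewrite /z -cisMn -cisN sub_cis mxE; congr (_ * (sin _)%:C%C).
by rewrite -[RHS]mulr_natr -mulnA !natrM; ring.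
Qed.

(** As w^m = - 1, the number - w is an m-th root of unity, and its square w^2
    has order m. *)
Lemma prim_root_opp (F : fieldType) m (w : F) : odd m ->
  (2 * m).-primitive_root w -> m.-primitive_root (- w).
Proof.
move=> m_odd w_prim; have m_gt0 : (0 < m)%N by case: m m_odd {w_prim}.
have wN : w ^+ m = -1.
  have /eqP := prim_expr_order w_prim; rewrite mulnC exprM -{1}(expr1n _ 2) eqf_sqr.
  case/orP => /eqP // /eqP; rewrite -(prim_order_dvd w_prim).
  by move/(dvdn_leq m_gt0); lia.
have wm1 : (- w) ^+ m = 1 by rewrite exprNn -signr_odd m_odd wN mulrNN mulr1.
have [d d_prim d_m] := prim_order_exists m_gt0 wm1.
suff -> : m = d by [].
apply/eqP; rewrite eqn_dvd d_m andbT -(@dvdn_pmul2l 2) //.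
rewrite (prim_order_dvd w_prim) exprM -sqrrN -exprM mulnC exprM.
by rewrite (prim_expr_order d_prim) expr1n.
Qed.

Lemma nonsquarefree_prime n : (0 < n)%N -> ~~ squarefree n ->
  exists2 p, prime p & (p * p %| n)%N.
Proof.
move=> n_gt0; rewrite /squarefree negb_forall => /existsP[d].
rewrite negb_imply => /andP[d2_n d_neq1].
have d_gt1 : (1 < d)%N.
  rewrite ltn_neqAle eq_sym d_neq1 lt0n; apply: contraTneq d2_n => ->.
  by rewrite exp0n // dvd0n -lt0n.
exists (pdiv d); first exact: pdiv_prime.
by apply: dvdn_trans d2_n; rewrite -mulnn dvdn_mul ?pdiv_dvd.
Qed.

(* For n = 4 the matrix is the 1 x 1 matrix (sin (pi / 2)) = (1), although 4 is
   not square-free: the formula fails there, and only there. *)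
Theorem theorem1p12 (R : realType) (n : nat) (n_ge3 : (3 <= n)%N)
    (n_neq4 : n <> 4%N) :
  `|\det (sin_mx R n)| =
    if odd n && squarefree n then
      2 `^ (- ((totient n)%:R / 2)) *
        \prod_(i : Iirr (units_Zp n) | odd_char i)
          Num.sqrt (conductor i)%:R
    else if ~~ odd n && squarefree n then
      2 `^ (- ((totient (n %/ 2))%:R / 2)) *
        \prod_(i : Iirr (units_Zp (n %/ 2)) | odd_char i)
          Num.sqrt (conductor i)%:R
    else 0.
Proof.
have n_gt0 : (0 < n)%N by apply: leq_trans n_ge3.
have z_prim := cis_prim_root R n_gt0; set z := cis _ in z_prim.
have zn := prim_expr_order z_prim.
have c2 : (2 * 'i%C) ^+ 2 = - 4 :> R[i] by rewrite exprMn sqr_i; ring.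
have sinE : (2 * 'i%C) *: map_mx (real_complex R) (sin_mx R n) = sine_mx n (@S_val n) z.
  apply/matrixP => j k; rewrite [LHS]mxE [in LHS]mxE [RHS]mxE sin_mxE //.
  by rewrite (expr_pred_order _ n_gt0 zn).
have [sq|nsq] := boolP (squarefree n); rewrite ?andbT ?andbF; last first.
  have [p p_prime p2_n] := nonsquarefree_prime n_gt0 nsq.
  have [d n_pd p_d] : exists2 d, n = (p * d)%N & (p %| d)%N.
    by case/dvdnP: p2_n => q ->; exists (q * p)%N; rewrite ?dvdn_mull // mulnCA mulnA.
  have p_gt1 := prime_gt1 p_prime.
  have d_gt2 : (2 < d)%N.
    have d_gt0 : (0 < d)%N by move: n_gt0; rewrite n_pd muln_gt0 => /andP[].
    have le_pd := dvdn_leq d_gt0 p_d.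
    by rewrite ltnNge; apply/negP => d_le2; apply: n_neq4; rewrite n_pd; nia.
  have sH := half_system_S_set n_ge3.
  have := congr1 determinant sinE; rewrite detZ det_map_mx.
  have -> : \det (sine_mx n (@S_val n) z) = 0.
    by move: (@S_val n) sH z z_prim {sinE zn}; rewrite n_pd => s sH z; apply: det_sine_mx_eq0.
  move/eqP; rewrite mulf_eq0 expf_eq0 (negPf (_ : 2 * 'i%C != 0)) ?andbF /=; last first.
    by move/eqP: c2; apply: contraTneq => ->; rewrite expr0n /= eq_sym oppr_eq0 pnatr_eq0.
  by rewrite fmorph_eq0 => /eqP ->; rewrite normr0.
case: ifPn => n_odd.
  exact: (abs_det_half_system n_ge3 sq (half_system_S_set n_ge3) z_prim c2 sinE).
pose m := (n %/ 2)%N; have n_2m : n = (2 * m)%N by rewrite /m; lia.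
rewrite n_odd -/m.
clearbody m; subst n.
have m_odd : odd m.
  apply: contraLR sq => m_even; apply/forallPn; have lt2 : (2 < (2 * m).+1)%N by lia.
  exists (Ordinal lt2); rewrite negb_imply /= andbT -mulnn dvdn_pmul2l // dvdn2.
  by rewrite m_even.
have m_gt2 : (2 < m)%N by lia.
have [sH s_odd] := half_system_S_set_double m_odd m_gt2.
have sq_m := squarefree_dvd n_gt0 (dvdn_mull 2 (dvdnn m)) sq.
have zN_prim := prim_root_opp m_odd z_prim.
apply: (abs_det_half_system m_gt2 sq_m sH zN_prim (c := - (2 * 'i%C))).
  by rewrite sqrrN.
apply/matrixP => j k; rewrite [LHS]mxE [X in _ * X]mxE mulNr sin_mxE // mxE.
rewrite (expr_pred_order _ (ltnW (ltnW m_gt2)) (prim_expr_order zN_prim)).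
(* The exponents are odd, so that passing from z to - z changes the sign. *)
rewrite [(- z) ^+ _]exprNn -signr_odd oddM !s_odd /= expr1 !mulN1r invrN.
by rewrite opprB addrC opprK.
Qed.
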